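(* Let $K$ be a commutative field, let $x_1,\ldots,x_r\in K$ be pairwise distinct, and let $m_1,\ldots,m_r$ be positive integers. Let $\omega$ and $h_1,\ldots,h_r\in K[t]$ be the polynomials defined in the context. Then the canonical ring homomorphism $$K[t]/(\omega)\longrightarrow K[t]/(t-x_1)^{m_1}\times\cdots\times K[t]/(t-x_r)^{m_r}$$ is an isomorphism, and its inverse is given explicitly by $$\Bigl(g_1 \bmod (t-x_1)^{m_1},\ldots,g_r \bmod (t-x_r)^{m_r}\Bigr)\longmapsto \sum_{i=1}^r h_i g_i \bmod \omega .$$ Equivalently, every polynomial $F\in K[t]$ satisfies $$F\equiv\sum_{i=1}^r h_i g_i \quad\bmod \omega,$$ where $g_i$ denotes the remainder of $F$ modulo $(t-x_i)^{m_i}$.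
   Context: Notation: $\omega(t)=\prod_{j=1}^r (t-x_j)^{m_j}$. For each $i\in\{1,\ldots,r\}$ set $$\phi_i(t)=\prod_{j\ne i}(t-x_j)^{m_j},\qquad q_i(t)=\frac{\phi_i(t)}{\phi_i(x_i)},\qquad h_i(t)=1-\left(1-q_i(t)\right)^{m_i}.$$ Empty products equal $1$. *)

(* Defs.v *)
From HB Require Import structures.
From mathcomp Require Import all_boot all_order all_algebra.

Set Implicit Arguments.
Unset Strict Implicit.
Unset Printing Implicit Defensive.

Import GRing.Theory.
Local Open Scope ring_scope.
Local Open Scope quotient_scope.

Section PolyQuotient.

Variables (K : fieldType) (p : {poly K}).

Definition poly_ideal : {pred {poly K}} := [pred f | p %| f].

Fact poly_ideal_zmod_closed : zmod_closed poly_ideal.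
Proof. by split=> [|f g pf pg]; rewrite inE ?dvdp0 ?dvdp_sub. Qed.

HB.instance Definition _ :=
  GRing.isZmodClosed.Build {poly K} poly_ideal poly_ideal_zmod_closed.

(* K[t]/(p) for an arbitrary p. The ring structures that the library puts on  *)
(* {ideal_quot I} and on {poly %/ p} are those of nonzero rings; the quotient *)
(* by (1) is needed when there are no nodes, hence the instance given here.   *)
Definition polyquot : Type := {ideal_quot poly_ideal}.

HB.instance Definition _ := GRing.Zmodule.on polyquot.

(* The class of f modulo p. *)
Definition polyclass (f : {poly K}) : polyquot := \pi_{ideal_quot poly_ideal} f.

Definition polyrepr (u : polyquot) : {poly K} :=
  repr (u : {ideal_quot poly_ideal}).

Fact polyreprK : cancel polyrepr polyclass.
Proof. exact: reprK. Qed.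

Fact polyclass_eqP (f g : {poly K}) :
  reflect (polyclass f = polyclass g) (p %| f - g).
Proof.
have -> : (p %| f - g) = (f == g %[mod {ideal_quot poly_ideal}]).
  by rewrite -Quotient.idealrBE.
exact: eqP.
Qed.

Fact polyclass_zmod_morphism : zmod_morphism polyclass.
Proof. exact: pi_is_zmod_morphism. Qed.

HB.instance Definition _ :=
  GRing.isZmodMorphism.Build {poly K} polyquot polyclass
    polyclass_zmod_morphism.

Definition polyquot_mul (u v : polyquot) : polyquot :=
  polyclass (polyrepr u * polyrepr v).

Fact polyclassM : {morph polyclass : f g / f * g >-> polyquot_mul f g}.
Proof.
have dvd_repr k : p %| k - polyrepr (polyclass k).
  by apply/polyclass_eqP; rewrite polyreprK.
move=> f g; apply/polyclass_eqP.
rewrite -[X in X - _](subrK (polyrepr (polyclass f) * g)) -mulrBl.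
rewrite -addrA -mulrBr.
by apply: dvdp_add; [apply: dvdp_mulr | apply: dvdp_mull].
Qed.

Fact polyquot_mulA : associative polyquot_mul.
Proof.
move=> u v w; rewrite -[u]polyreprK -[v]polyreprK -[w]polyreprK.
by rewrite -!polyclassM mulrA.
Qed.

Fact polyquot_mulC : commutative polyquot_mul.
Proof. by move=> u v; rewrite /polyquot_mul mulrC. Qed.

Fact polyquot_mul1 : left_id (polyclass 1) polyquot_mul.
Proof. by move=> u; rewrite -[u]polyreprK -polyclassM mul1r. Qed.

Fact polyquot_mulDl : left_distributive polyquot_mul +%R.
Proof.
move=> u v w; rewrite -[u]polyreprK -[v]polyreprK -[w]polyreprK.
by rewrite -raddfD -!polyclassM -raddfD mulrDl.
Qed.

HB.instance Definition _ := GRing.Zmodule_isComPzRing.Build polyquot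
  polyquot_mulA polyquot_mulC polyquot_mul1 polyquot_mulDl.

HB.instance Definition _ :=
  GRing.isMonoidMorphism.Build {poly K} polyquot polyclass
    (conj (erefl _) polyclassM).

End PolyQuotient.

Section ProductRing.

Variables (I : finType) (R : I -> comPzRingType).

(* The product ring of a family R_i; the library only provides the case where *)
(* R does not depend on i.                                                    *)
Definition prodring : Type := {dffun forall i, R i}.

HB.instance Definition _ := Choice.on prodring.

Definition mkprod (f : forall i, R i) : prodring := finfun f.

Implicit Types u v w : prodring.
Definition prodring_zero : prodring := mkprod (fun=> 0).
Definition prodring_opp u : prodring := mkprod (fun i => - u i).
Definition prodring_add u v : prodring := mkprod (fun i => u i + v i).
Definition prodring_one : prodring := mkprod (fun=> 1).
Definition prodring_mul u v : prodring := mkprod (fun i => u i * v i).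

Fact prodring_addA : associative prodring_add.
Proof. by move=> u v w; apply/ffunP=> i; rewrite !ffunE addrA. Qed.
Fact prodring_addC : commutative prodring_add.
Proof. by move=> u v; apply/ffunP=> i; rewrite !ffunE addrC. Qed.
Fact prodring_add0 : left_id prodring_zero prodring_add.
Proof. by move=> u; apply/ffunP=> i; rewrite !ffunE add0r. Qed.
Fact prodring_addN : left_inverse prodring_zero prodring_opp prodring_add.
Proof. by move=> u; apply/ffunP=> i; rewrite !ffunE addNr. Qed.

HB.instance Definition _ := GRing.isZmodule.Build prodring
  prodring_addA prodring_addC prodring_add0 prodring_addN.

Fact prodring_mulA : associative prodring_mul.
Proof. by move=> u v w; apply/ffunP=> i; rewrite !ffunE mulrA. Qed.
Fact prodring_mulC : commutative prodring_mul.
Proof. by move=> u v; apply/ffunP=> i; rewrite !ffunE mulrC. Qed.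
Fact prodring_mul1 : left_id prodring_one prodring_mul.
Proof. by move=> u; apply/ffunP=> i; rewrite !ffunE mul1r. Qed.
Fact prodring_mulDl : left_distributive prodring_mul +%R.
Proof. by move=> u v w; apply/ffunP=> i; rewrite !ffunE mulrDl. Qed.

HB.instance Definition _ := GRing.Zmodule_isComPzRing.Build prodring
  prodring_mulA prodring_mulC prodring_mul1 prodring_mulDl.

End ProductRing.

Section HermiteData.

Variables (K : fieldType) (r : nat) (x : 'I_r -> K) (m : 'I_r -> nat).

Definition node_pow (i : 'I_r) : {poly K} := ('X - (x i)%:P) ^+ m i.

Definition omega : {poly K} := \prod_(j < r) node_pow j.

Definition phi (i : 'I_r) : {poly K} := \prod_(j < r | j != i) node_pow j.

Definition q (i : 'I_r) : {poly K} := (phi i).[x i]^-1 *: phi i.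

Definition h (i : 'I_r) : {poly K} := 1 - (1 - q i) ^+ m i.

End HermiteData.

(* Main.v *)
Require Import Defs.
From HB Require Import structures.
From mathcomp Require Import all_boot all_order all_algebra.

Set Implicit Arguments.
Unset Strict Implicit.
Unset Printing Implicit Defensive.

Import GRing.Theory.
Local Open Scope ring_scope.

(** The polynomials [h i] are orthogonal idempotents modulo [omega]: each is
    congruent to 1 modulo its own factor and to 0 modulo every other one.  Both
    congruences come from the geometric factorisation of
    [1 - (1 - q i) ^+ m i].  The factor [q i], hence [h i], is a multiple of
    [node_pow x m j] for all [j != i]; and since [q i] takes the value 1 at
    [x i], the polynomial ['X - (x i)%:P] divides [1 - q i], so that its power
    [m i] divides [1 - h i] ([dvdp_node_pow_h], [dvdp_node_pow_1h]).
    Consequently [\sum_i h i * g i] is congruent to [g i] modulo the factor of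
    index [i] ([hermite_sum_mod]).

    On the other hand, powers at distinct nodes are coprime, so a polynomial is
    divisible by [omega] as soon as all the factors divide it ([dvdp_omega]).
    This is the injectivity of the canonical map, and it turns the congruences
    modulo the factors into congruences modulo [omega].  Surjectivity, with the
    formula for the inverse, is [hermite_sum_mod]; the inverse of a bijective
    ring homomorphism is again a ring homomorphism. *)

(** * Congruences for the polynomials h *)

Lemma coprimep_prodr (K : fieldType) (I : Type) (s : seq I) (P : pred I)
    (F : I -> {poly K}) (p : {poly K}) :
  (forall i, P i -> coprimep p (F i)) ->
  coprimep p (\prod_(i <- s | P i) F i).
Proof.
move=> copF; elim/big_ind: _ => // [|u v cpu cpv]; first exact: coprimep1.
by rewrite coprimepMr cpu.
Qed.

Lemma dvdp_prod_coprime (K : fieldType) (I : eqType) (s : seq I)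
    (F : I -> {poly K}) (p : {poly K}) :
    uniq s -> (forall i j, i != j -> coprimep (F i) (F j)) ->
  (\prod_(i <- s) F i %| p) = all (fun i => F i %| p) s.
Proof.
move=> + copF; elim: s => [|i s IHs] /=; first by rewrite big_nil dvd1p.
case/andP=> i_notin_s uniq_s; rewrite big_cons Gauss_dvdp ?IHs //.
rewrite big_seq; apply: coprimep_prodr => j j_in_s; apply: copF.
by apply: contraNneq i_notin_s => ->.
Qed.

Lemma coprimep_node_pow (K : fieldType) (r : nat) (x : 'I_r -> K)
    (m : 'I_r -> nat) (i j : 'I_r) :
  injective x -> i != j -> coprimep (node_pow x m i) (node_pow x m j).
Proof.
move=> x_inj neq_ij; rewrite /node_pow coprimep_expl ?coprimep_expr //.
by rewrite coprimep_XsubC root_XsubC (inj_eq x_inj) eq_sym.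
Qed.

Lemma dvdp_omega (K : fieldType) (r : nat) (x : 'I_r -> K) (m : 'I_r -> nat)
    (p : {poly K}) :
  injective x ->
  (omega x m %| p) = [forall i, node_pow x m i %| p].
Proof.
move=> x_inj; rewrite /omega dvdp_prod_coprime ?index_enum_uniq //; last first.
  by move=> i j; apply: coprimep_node_pow.
apply/allP/forallP => [dvd_p i | dvd_p i _] //.
by apply: dvd_p; rewrite mem_index_enum.
Qed.

(** Distinctness of the nodes makes the normalising constant [(phi i).[x i]]
    nonzero, which is what the value of [q i] depends on. *)
Lemma horner_q_node (K : fieldType) (r : nat) (x : 'I_r -> K)
    (m : 'I_r -> nat) (i : 'I_r) :
  injective x -> (q x m i).[x i] = 1.
Proof.
move=> x_inj; rewrite /q hornerZ mulVf // /phi horner_prod.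
apply/prodf_neq0 => j neq_ji.
by rewrite /node_pow !hornerE expf_neq0 // subr_eq0 (inj_eq x_inj) eq_sym.
Qed.

(** The first factor of [1 - (1 - q i) ^+ m i = q i * \sum_k (1 - q i) ^+ k] is
    a scalar multiple of [phi i], in which [node_pow x m j] occurs. *)
Lemma dvdp_node_pow_h (K : fieldType) (r : nat) (x : 'I_r -> K)
    (m : 'I_r -> nat) (i j : 'I_r) :
  j != i -> node_pow x m j %| h x m i.
Proof.
move=> neq_ji; rewrite /h.
have -> : 1 - (1 - q x m i) ^+ m i
    = q x m i * \sum_(k < m i) (1 - q x m i) ^+ k.
  by rewrite -opprB subrX1 -mulNr opprB subKr.
apply: dvdp_mulr; rewrite /q /phi (bigD1 j) //= scalerAr.
exact: dvdp_mulIl.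
Qed.

(** Since [q i] takes the value 1 at [x i], the base of the power
    [1 - h i = (1 - q i) ^+ m i] vanishes there. *)
Lemma dvdp_node_pow_1h (K : fieldType) (r : nat) (x : 'I_r -> K)
    (m : 'I_r -> nat) (i : 'I_r) :
  injective x -> node_pow x m i %| 1 - h x m i.
Proof.
move=> x_inj; rewrite /h subKr; apply: dvdp_exp2r.
by rewrite dvdp_XsubCl rootE hornerD hornerN hornerC horner_q_node // subrr.
Qed.

Lemma hermite_sum_mod (K : fieldType) (r : nat) (x : 'I_r -> K)
    (m : 'I_r -> nat) (g : 'I_r -> {poly K}) (i : 'I_r) :
  injective x -> node_pow x m i %| g i - \sum_(j < r) h x m j * g j.
Proof.
move=> x_inj; rewrite (bigD1 i) //= opprD addrA -[X in X - _ - _]mul1r -mulrBl.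
apply: dvdp_sub; first by rewrite dvdp_mulr ?dvdp_node_pow_1h.
elim/big_ind: _ => [|u v|j neq_ji]; [exact: dvdp0 | exact: dvdp_add |].
by rewrite dvdp_mulr ?dvdp_node_pow_h 1?eq_sym.
Qed.

(** * The canonical homomorphism *)

(** Choosing a representative gives a total map on the quotient without a
    compatibility proof; [residuesE] shows that the choice does not matter. *)
Definition residues (K : fieldType) (r : nat) (x : 'I_r -> K) (m : 'I_r -> nat)
    (u : polyquot (omega x m)) :
    prodring (fun i : 'I_r => polyquot (node_pow x m i)) :=
  mkprod (fun i : 'I_r => polyclass (node_pow x m i) (polyrepr u)).

Definition hermite (K : fieldType) (r : nat) (x : 'I_r -> K) (m : 'I_r -> nat)
    (v : prodring (fun i : 'I_r => polyquot (node_pow x m i))) :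
    polyquot (omega x m) :=
  polyclass (omega x m) (\sum_(i < r) h x m i * polyrepr (v i)).

Lemma dvdp_node_pow_omega (K : fieldType) (r : nat) (x : 'I_r -> K)
    (m : 'I_r -> nat) (i : 'I_r) : node_pow x m i %| omega x m.
Proof. by rewrite /omega (bigD1 i) //= dvdp_mulr. Qed.

Lemma residuesE (K : fieldType) (r : nat) (x : 'I_r -> K) (m : 'I_r -> nat)
    (F : {poly K}) :
  residues (polyclass (omega x m) F)
    = mkprod (fun i : 'I_r => polyclass (node_pow x m i) F).
Proof.
apply/ffunP=> i; rewrite !ffunE; apply/polyclass_eqP.
apply: dvdp_trans (dvdp_node_pow_omega x m i) _.
by apply/polyclass_eqP; rewrite polyreprK.
Qed.

Lemma residues_zmod_morphism (K : fieldType) (r : nat) (x : 'I_r -> K)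
    (m : 'I_r -> nat) : zmod_morphism (@residues K r x m).
Proof.
move=> u v; rewrite -[u]polyreprK -[v]polyreprK -raddfB !residuesE.
by apply/ffunP=> i; rewrite !ffunE raddfB.
Qed.

Lemma residues_monoid_morphism (K : fieldType) (r : nat) (x : 'I_r -> K)
    (m : 'I_r -> nat) : monoid_morphism (@residues K r x m).
Proof.
split=> [|u v]; first exact: residuesE.
rewrite -[u]polyreprK -[v]polyreprK -rmorphM !residuesE.
by apply/ffunP=> i; rewrite !ffunE rmorphM.
Qed.

HB.instance Definition _ (K : fieldType) (r : nat) (x : 'I_r -> K)
    (m : 'I_r -> nat) :=
  GRing.isZmodMorphism.Build _ _ (@residues K r x m)
    (@residues_zmod_morphism K r x m).

HB.instance Definition _ (K : fieldType) (r : nat) (x : 'I_r -> K)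
    (m : 'I_r -> nat) :=
  GRing.isMonoidMorphism.Build _ _ (@residues K r x m)
    (@residues_monoid_morphism K r x m).

(** Surjectivity of the canonical map, with an explicit preimage. *)
Lemma residues_hermite_sum (K : fieldType) (r : nat) (x : 'I_r -> K)
    (m : 'I_r -> nat) (g : 'I_r -> {poly K}) :
  injective x ->
  residues (polyclass (omega x m) (\sum_(i < r) h x m i * g i))
    = mkprod (fun i : 'I_r => polyclass (node_pow x m i) (g i)).
Proof.
move=> x_inj; rewrite residuesE; apply/ffunP=> i; rewrite !ffunE.
by apply/esym/polyclass_eqP/hermite_sum_mod.
Qed.

(** This is where coprimality of the factors enters: a difference divisible by
    all of them is divisible by [omega]. *)
Lemma residues_inj (K : fieldType) (r : nat) (x : 'I_r -> K)
    (m : 'I_r -> nat) : injective x -> injective (@residues K r x m).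
Proof.
move=> x_inj u v; rewrite -[u]polyreprK -[v]polyreprK !residuesE => /ffunP eq_uv.
apply/polyclass_eqP; rewrite dvdp_omega //; apply/forallP=> i.
by apply/polyclass_eqP; have := eq_uv i; rewrite !ffunE.
Qed.

Lemma hermiteK (K : fieldType) (r : nat) (x : 'I_r -> K) (m : 'I_r -> nat) :
  injective x -> cancel (@hermite K r x m) (@residues K r x m).
Proof.
move=> x_inj v; rewrite residues_hermite_sum //.
by apply/ffunP=> i; rewrite ffunE polyreprK.
Qed.

Lemma residuesK (K : fieldType) (r : nat) (x : 'I_r -> K) (m : 'I_r -> nat) :
  injective x -> cancel (@residues K r x m) (@hermite K r x m).
Proof. by move=> x_inj; apply: (inj_can_sym (hermiteK _)) (residues_inj _). Qed.

Theorem mainTheorem4 (K : fieldType) (r : nat)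
    (x : 'I_r -> K) (m : 'I_r -> nat)
    (x_inj : injective x) (m_gt0 : forall i : 'I_r, (0 < m i)%N) :
  let Q := polyquot (omega x m) in
  let P := prodring (fun i : 'I_r => polyquot (node_pow x m i)) in
  (exists (Phi : {rmorphism Q -> P}) (Psi : {rmorphism P -> Q}),
     [/\ forall F : {poly K},
           Phi (polyclass (omega x m) F)
             = mkprod (fun i : 'I_r => polyclass (node_pow x m i) F),
         cancel Phi Psi,
         cancel Psi Phi
       & forall g : 'I_r -> {poly K},
           Psi (mkprod (fun i : 'I_r => polyclass (node_pow x m i) (g i)))
             = polyclass (omega x m) (\sum_(i < r) h x m i * g i)])
  /\
  (forall F : {poly K},
     omega x m %| F - \sum_(i < r) h x m i * (F %% node_pow x m i)).
Proof.
move=> Q P; split.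
  pose Phi : {rmorphism Q -> P} := @residues K r x m.
  have PhiK : cancel Phi (@hermite K r x m) by apply: residuesK.
  have PsiK : cancel (@hermite K r x m) Phi by apply: hermiteK.
  pose psi_zmod := GRing.isZmodMorphism.Build P Q (@hermite K r x m)
    (can2_zmod_morphism PhiK PsiK).
  pose psi_monoid := GRing.isMonoidMorphism.Build P Q (@hermite K r x m)
    (can2_monoid_morphism PhiK PsiK).
  pose Psi : {rmorphism P -> Q} :=
    HB.pack (@hermite K r x m) psi_zmod psi_monoid.
  exists Phi, Psi; split=> // [F|g]; first exact: residuesE.
  by apply: (canLR PhiK); rewrite -residues_hermite_sum.
move=> F; rewrite dvdp_omega //; apply/forallP=> i.
(* The interpolated data are the remainders of F, which differ from F by
   multiples of the factors. *)
rewrite -[F in F - _](subrK (F %% node_pow x m i)) -addrA.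
apply: dvdp_add; last exact: (hermite_sum_mod m (fun j => F %% node_pow x m j)).
by rewrite {1}(divp_eq F (node_pow x m i)) addrK dvdp_mull.
Qed.
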